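(* Let $\mathbf{S}$ be a finite monoid. Suppose there exist positive integers $p,q$ such that $\mathbf{S}$ satisfies the following: (i) for any $m,n\in\mathbb{N}$, $\mathbf{S}\models\mathcal{R}_{n,p,q}\overline{\mathcal{R}_{m,p,q}}\approx\overline{\mathcal{R}_{m,p,q}}\mathcal{R}_{n,p,q}$; (ii) $\mathbf{S}\models\mathscr{A}_{\alpha,\beta}$ for some $\alpha,\beta\in\mathbb{N}$ with $\alpha\le 2p+2q$; (iii) $x^py^{p+q}x^q$ is an isoterm for $\mathbf{S}$; (iv) $\{x^py^px^qy^q,\ y^px^py^qx^q,\ x^{p+q}y^{p+q},\ y^{p+q}x^{p+q}\}$ is an island for $\mathbf{S}$. Then $\mathbf{S}$ is non-finitely related.
   Context: $\mathbb{N}=\{1,2,3,\dots\}$. An operation $f:A^n\to A$ preserves a relation $R\subseteq A^k$ if $f(r_1,\dots,r_n)\in R$ for all $r_1,\dots,r_n\in R$, with $f$ applied coordinatewise. An algebra $\mathbf{A}$ with universe $A$ is finitely related if there is a finite set of finitary relations on $A$ such that the finitary operations on $A$ preserving all of those relations are precisely the term functions of $\mathbf{A}$; otherwise it is non-finitely related. Monoids are regarded as algebras with a single binary operation; the $n$-ary term functions are those induced by words in $n$ variables. For $n,p,q\in\mathbb{N}$ the crown word on $n$ variables is $$\mathcal{R}_{n,p,q}=x_1^p\cdot\Bigl(\prod_{k=1}^{\frac n2-1}x_{2k+1}^px_{2k}^{p+q}x_{2k-1}^q\Bigr)\cdot x_n^{p+q}x_{n-1}^q\quad\text{if } n \text{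 is even},$$ $$\mathcal{R}_{n,p,q}=x_1^p\cdot\Bigl(\prod_{k=1}^{\frac{n-1}2}x_{2k+1}^px_{2k}^{p+q}x_{2k-1}^q\Bigr)\cdot x_n^q\quad\text{if } n \text{ is odd},$$ where products are taken in increasing order of $k$. $\overline{\mathcal{R}_{m,p,q}}$ denotes the crown word over a disjoint set of variables $y_1,\dots,y_m$. $\mathscr{A}_{\alpha,\beta}$ is the set of identities $\{x^\alpha\approx x^{\alpha+\beta},\ t_1xt_2x\cdots t_\alpha x\approx x^\alpha t_1t_2\cdots t_\alpha\}$. A word $\mathbf{w}$ is an isoterm for $\mathbf{S}$ if, for every word $\mathbf{u}$, $\mathbf{S}\models\mathbf{u}\approx\mathbf{w}$ implies $\mathbf{u}=\mathbf{w}$. A set of words $\{\mathbf{u}_1,\dots,\mathbf{u}_r\}$ is an island for $\mathbf{S}$ if $\mathbf{S}\models\mathbf{u}_i\approx\mathbf{u}_j$ for all $i,j$, and for every word $\mathbf{v}$ and every $i$, $\mathbf{S}\models\mathbf{u}_i\approx\mathbf{v}$ if and only if $\mathbf{v}=\mathbf{u}_k$ for some $k$. *)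

(* Defs.v *)
From mathcomp Require Import all_boot.

Set Implicit Arguments.
Unset Strict Implicit.
Unset Printing Implicit Defensive.

(* [f] is applied coordinatewise to the [n] rows [r i] of arity [k]. *)
Definition preserves (A : Type) (n k : nat) (f : n.-tuple A -> A)
    (R : k.-tuple A -> Prop) : Prop :=
  forall r : n.-tuple (k.-tuple A),
    (forall i : 'I_n, R (tnth r i)) ->
    R [tuple f [tuple tnth (tnth r i) j | i < n] | j < k].

(* [T n] is the set of [n]-ary term functions of the algebra. Operations have
   positive arity; nullary relations are allowed, but every operation of
   positive arity preserves them. *)
Definition finitely_related (A : Type)
    (T : forall n : nat, (n.-tuple A -> A) -> Prop) : Prop :=
  exists (r : nat) (k : 'I_r -> nat)
      (R : forall i : 'I_r, (k i).-tuple A -> Prop),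
    forall (n : nat) (f : n.-tuple A -> A), 0 < n ->
      (forall i : 'I_r, preserves f (R i)) <-> T n f.

(* A word is a nonempty sequence of letters, since the identity element is not
   an operation of the algebra. *)
Definition word_eval (S : Type) (one : S) (mul : Monoid.law one)
    (X : Type) (a : X -> S) (w : seq X) : S :=
  \big[mul/one]_(x <- w) a x.

Definition term_function (S : Type) (one : S) (mul : Monoid.law one)
    (n : nat) (f : n.-tuple S -> S) : Prop :=
  exists2 w : seq 'I_n, w != [::] &
    forall a : n.-tuple S, f a = word_eval mul (tnth a) w.

(* Identities are over the countably infinite alphabet [nat]. *)
Definition satisfies (S : Type) (one : S) (mul : Monoid.law one)
    (u v : seq nat) : Prop :=
  forall a : nat -> S, word_eval mul a u = word_eval mul a v.

Definition isoterm (S : Type) (one : S) (mul : Monoid.law one)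
    (w : seq nat) : Prop :=
  forall u : seq nat, u != [::] -> satisfies mul u w -> u = w.

Definition island (S : Type) (one : S) (mul : Monoid.law one)
    (us : seq (seq nat)) : Prop :=
  (forall u u', u \in us -> u' \in us -> satisfies mul u u') /\
  (forall u v, u \in us -> v != [::] -> (satisfies mul u v <-> v \in us)).

(* The crown word on the variables [x 1], ..., [x n]. *)
Definition crown (x : nat -> nat) (n p q : nat) : seq nat :=
  let block k :=
    nseq p (x k.*2.+1) ++ nseq (p + q) (x k.*2) ++ nseq q (x k.*2.-1) in
  if odd n then
    nseq p (x 1) ++ \big[cat/[::]]_(1 <= k < n./2.+1) block k ++ nseq q (x n)
  else
    nseq p (x 1) ++ \big[cat/[::]]_(1 <= k < n./2) block k
      ++ nseq (p + q) (x n) ++ nseq q (x n.-1).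

(* Two disjoint families of variables, x_i and y_i. *)
Definition xvar (i : nat) : nat := i.*2.
Definition yvar (i : nat) : nat := i.*2.+1.

(* Here x is the letter 0 and t_i is the letter i. *)
Definition satisfies_A (S : Type) (one : S) (mul : Monoid.law one)
    (alpha beta : nat) : Prop :=
  satisfies mul (nseq alpha 0) (nseq (alpha + beta) 0) /\
  satisfies mul (flatten [seq [:: t; 0] | t <- iota 1 alpha])
                (nseq alpha 0 ++ iota 1 alpha).

(* Main.v *)
Require Import Defs.
From mathcomp Require Import all_boot.
From mathcomp Require Import zify.

Set Implicit Arguments.
Unset Strict Implicit.
Unset Printing Implicit Defensive.

(** The obstruction is a crown closed into a cycle.  Take [m] outer letters
    o_0, ..., o_(m-1) and [m] inner letters e_0, ..., e_(m-1), indexed modulo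
    [m], with e_k lying between o_k and o_(k+1).  A crown word for this cyclic
    pattern would have to nest every inner letter inside its two neighbouring
    outer letters, as in o^p e^(p+q) o^q, while every other pair of letters is
    left unnested.  The blocks B_k = o_(k+1)^p e_k^(p+q) o_k^q, multiplied in
    cyclic order starting from B_i, give a word W_i which does this for all
    pairs except those involving o_i, where the cycle has been cut.

    If two outer letters o_i and o_j take the same value s, they occur together
    2p + 2q >= alpha times in W_i, so the identities of A_(alpha,beta) move all
    these occurrences to the front.  What remains is W_i evaluated at
    o_i = o_j = 1, so the place of the cut has become harmless.  More precisely,
    if the values of the outer letters numbered i and k are both repeated, then
    W_i and W_k have the same value: after extraction of both values the two
    words are the products, in the two orders, of two stretches of the cycle
    whose end letters are equal to 1; such stretches are values of crown words,
    and crown words commute ([eval_cyclic_word_repeat]).  As soon as m > |S|,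
    every tuple repeats a value among its outer letters, hence these local
    values glue to a function [glued] of 2m variables.

    This function preserves every relation that is invariant under the term
    functions and has fewer than m elements: among any 2m rows of the relation
    two outer ones coincide, and there the function is the term function W_i
    ([glued_preserves]).  Since S is finite, m can be chosen to work for any
    prescribed finite set of relations.

    It is not a term function ([glued_not_term]). If a set of letters avoids
    o_i and another outer letter, then the projections to this set of W_i and
    of a word w inducing the function are equivalent. So the isoterm fixes the
    projection of w to each neighbouring pair, and the island allows only four
    unnested projections for each other pair. Let A be the outer letter that
    starts first in w, and let B, C be its two neighbours among the outer
    letters, say B starts before C. The inner letter between A and C lies
    inside A and inside C; as A, B, C start in this order and are pairwise
    unnested, it also lies inside B ([no_straddling_letter]), which the island
    forbids. *)

(** * Extracting a frequent letter from a word *)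

Section Evaluation.

Variables (S : Type) (one : S) (mul : Monoid.law one).

Lemma word_eval_cat (L : Type) (a : L -> S) u v :
  word_eval mul a (u ++ v) = mul (word_eval mul a u) (word_eval mul a v).
Proof. exact: big_cat. Qed.

Lemma eq_word_eval_in (L : eqType) (a b : L -> S) w :
  {in w, a =1 b} -> word_eval mul a w = word_eval mul b w.
Proof. by move=> eq_ab; apply: eq_big_seq. Qed.

Lemma word_eval_map (L K : Type) (h : L -> K) (a : K -> S) w :
  word_eval mul a (map h w) = word_eval mul (a \o h) w.
Proof. exact: big_map. Qed.

Definition spow (s : S) (n : nat) : S := word_eval mul id (nseq n s).

Lemma spowD s m n : spow s (m + n) = mul (spow s m) (spow s n).
Proof. by rewrite /spow nseqD word_eval_cat. Qed.

Lemma spow1n n : spow one n = one.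
Proof.
rewrite /spow /word_eval; elim: n => [|n IHn]; first by rewrite big_nil.
by rewrite big_cons IHn Monoid.mulm1.
Qed.

Lemma word_eval_nseq (L : Type) (a : L -> S) n x :
  word_eval mul a (nseq n x) = spow (a x) n.
Proof. by rewrite /spow -map_nseq word_eval_map. Qed.

Variables alpha beta : nat.
Hypothesis alpha_gt0 : 0 < alpha.
Hypothesis mul_A : satisfies_A mul alpha beta.

Lemma collect_exact s ts : size ts = alpha ->
  \big[mul/one]_(t <- ts) mul t s =
  mul (spow s alpha) (\big[mul/one]_(t <- ts) t).
Proof.
move=> sz; case: mul_A => _.
move=> /(_ (fun z => if z is i.+1 then nth one ts i else s)).
rewrite word_eval_cat word_eval_nseq /word_eval big_flatten /= big_map.
have iE F : \big[mul/one]_(t <- ts) F t =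
    \big[mul/one]_(i <- iota 1 alpha) F (nth one ts i.-1).
  by rewrite (iotaDl 1 0) big_map (big_nth one) sz /index_iota subn0.
rewrite !iE => E.
rewrite [X in mul _ X](_ : _ = \big[mul/one]_(x <- iota 1 alpha)
    match x with 0 => s | i.+1 => nth one ts i end); last first.
  by apply: eq_big_seq => -[|i] //; rewrite mem_iota.
rewrite -E; apply: eq_big_seq => -[|i]; first by rewrite mem_iota.
by rewrite !big_cons big_nil Monoid.mulm1.
Qed.

(** Induction on the number of factors: once [alpha] copies of [s] stand in
    front, the last [alpha] - 1 of them and the next copy of [s] form another
    instance of the identity, all of whose variables but the last equal 1. *)
Lemma collect s ts : alpha <= size ts ->
  \big[mul/one]_(t <- ts) mul t s =
  mul (spow s (size ts)) (\big[mul/one]_(t <- ts) t).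
Proof.
elim/last_ind: ts => [|ts t IH]; first by move=> /=; lia.
rewrite size_rcons => le_a.
case: (ltngtP alpha (size ts).+1) le_a => // [lt_a|eq_a] _; last first.
  by rewrite collect_exact ?size_rcons -?eq_a.
rewrite -cats1 !big_cat !big_seq1 IH // /= -!Monoid.mulmA.
set T := \big[_/_]_(t <- ts) t; pose ss := rcons (nseq alpha.-1 one) (mul T t).
have ssE : size ss = alpha by rewrite size_rcons size_nseq prednK.
move: (collect_exact s ssE).
rewrite /ss -cats1 !big_cat !big_seq1 /=.
have -> : \big[mul/one]_(t <- nseq alpha.-1 one) t = one by exact: spow1n.
have -> : \big[mul/one]_(t <- nseq alpha.-1 one) mul t s = spow s alpha.-1.
  by rewrite /spow /word_eval; elim: (alpha.-1) => [|n IHn];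
     rewrite ?big_nil //= !big_cons -IHn Monoid.mul1m.
rewrite Monoid.mul1m -!Monoid.mulmA => E.
rewrite (_ : (size ts).+1 = (size ts - alpha).+1 + alpha); last by lia.
rewrite {1}(_ : size ts = (size ts - alpha).+1 + alpha.-1); last by lia.
rewrite !(spowD s (size ts - alpha).+1) -!Monoid.mulmA.
exact: congr1 E.
Qed.

(** The predicate [P] stands for a set of letters with a common value: the
    occurrences of two different letters that are assigned the same element
    have to be counted together. *)
Lemma extract_letter (L : Type) (a : L -> S) (P : pred L) s w :
    (forall x, P x -> a x = s) -> alpha <= count P w ->
  word_eval mul a w = mul (spow s (count P w))
    (word_eval mul (fun x => if P x then one else a x) w).
Proof.
move=> aP; set a' := fun x => _.
suff [ts [r [<- -> ->]]] : exists ts r, [/\ size ts = count P w,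
    word_eval mul a w = mul (\big[mul/one]_(t <- ts) mul t s) r &
    word_eval mul a' w = mul (\big[mul/one]_(t <- ts) t) r].
  by move=> le_a; rewrite collect // -Monoid.mulmA.
elim/last_ind: w => [|w x [ts [r [szE eE e'E]]]].
  by exists [::], one; rewrite /word_eval !big_nil Monoid.mul1m.
rewrite -cats1 !word_eval_cat eE e'E count_cat /= -szE /word_eval !big_seq1 /a'.
case: ifP => Px.
  exists (rcons ts r), one.
  rewrite size_rcons -cats1 !big_cat !big_seq1 (aP _ Px) !Monoid.mulm1.
  by rewrite -!Monoid.mulmA addn1.
by exists ts, (mul r (a x)); split; rewrite /= ?addn0 ?Monoid.mulmA.
Qed.

End Evaluation.

(** * The crown pattern on a cycle *)

Section CyclicWord.

Variables p q m : nat.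

Definition outer k := (k %% m).*2.
Definition inner k := (k %% m).*2.+1.

(** The factor x_(2k+1)^p x_(2k)^(p+q) x_(2k-1)^q of a crown word, with odd
    variables as outer letters and even variables as inner letters. *)
Definition block k :=
  nseq p (outer k.+1) ++ nseq (p + q) (inner k) ++ nseq q (outer k).

Definition crown_arc i h := flatten [seq block k | k <- iota i h].

Definition cyclic_word i := crown_arc i m.

Lemma crown_arcD i h h' :
  crown_arc i (h + h') = crown_arc i h ++ crown_arc (i + h) h'.
Proof. by rewrite /crown_arc iotaD map_cat flatten_cat. Qed.

Lemma crown_arc_periodic i h : crown_arc (m + i) h = crown_arc i h.
Proof.
rewrite /crown_arc iotaDl -map_comp; congr flatten; apply: eq_map => k.
by rewrite /block /outer /inner /= -addnS !modnDl.
Qed.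

Lemma cyclic_word_split i k : i <= k -> k <= i + m ->
  cyclic_word i = crown_arc i (k - i) ++ crown_arc k (i + m - k).
Proof.
move=> le_ik le_km; rewrite /cyclic_word.
have {1}-> : m = (k - i) + (i + m - k) by lia.
by rewrite crown_arcD; congr (_ ++ crown_arc _ _); lia.
Qed.

Lemma cyclic_word_rotate i k : i <= k -> k <= i + m ->
  cyclic_word k = crown_arc k (i + m - k) ++ crown_arc i (k - i).
Proof.
move=> le_ik le_km; rewrite (@cyclic_word_split k (i + m)); [|lia|lia].
by rewrite (addnC i m) crown_arc_periodic; congr (_ ++ crown_arc _ _); lia.
Qed.

Lemma perm_cyclic_word i k : i < m -> k < m ->
  perm_eq (cyclic_word i) (cyclic_word k).
Proof.
wlog le_ik : i k / i <= k => [wl lt_i lt_k|lt_i lt_k].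
  by case: (leqP i k) => [|/ltnW] le_ik; last rewrite perm_sym; apply: wl.
rewrite (@cyclic_word_split i k) ?(@cyclic_word_rotate i k) //; try lia.
by rewrite perm_catC.
Qed.

(** A letter [outer k] occurs [p] times in one block and [q] times in the next,
    so the count is [p + q] times the number of outer letters satisfying [P]. *)
Lemma count_cyclic_word (P : pred nat) i j k :
    (forall z, P z -> ~~ odd z) -> i < m -> j < m -> i != j -> k < m ->
    P (outer i) -> P (outer j) ->
  2 * p + 2 * q <= count P (cyclic_word k).
Proof.
move=> P_even lt_i lt_j neq_ij lt_k Pi Pj.
have /permP -> := @perm_cyclic_word k 0 lt_k ltac:(lia).
have E : count P (cyclic_word 0) =
    p * (\sum_(0 <= t < m) P (outer t.+1)) + q * \sum_(0 <= t < m) P (outer t).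
  rewrite /cyclic_word /crown_arc count_flatten -map_comp sumnE big_map.
  rewrite !big_distrr -big_split /= /index_iota subn0.
  apply: eq_bigr => t _; rewrite /block !count_cat !count_nseq.
  have /negbTE-> : ~~ P (inner t).
    by apply/negP => /P_even; rewrite /inner /= odd_double.
  by rewrite mul0n add0n !(mulnC (nat_of_bool _)).
have shift : \sum_(0 <= t < m) P (outer t.+1) = \sum_(0 <= t < m) P (outer t).
  apply: (@addnI (P (outer 0))).
  rewrite -(@big_nat_recl _ _ _ m 0 (fun t => nat_of_bool (P (outer t)))) //.
  by rewrite big_nat_recr //= addnC /outer modnn mod0n.
have ge2 : 2 <= \sum_(0 <= t < m) P (outer t).
  rewrite big_mkord (bigD1 (Ordinal lt_i)) //= (bigD1 (Ordinal lt_j)) /=.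
    by rewrite Pi Pj.
  by rewrite -val_eqE /= eq_sym.
rewrite E shift; nia.
Qed.

Lemma eval_crown_arcE (S : Type) (one : S) (mul : Monoid.law one)
    (a : nat -> S) i h :
  word_eval mul a (crown_arc i h) =
  \big[mul/one]_(0 <= k < h) word_eval mul a (block (i + k)).
Proof.
rewrite /word_eval /crown_arc big_flatten big_map -{1}(addn0 i) iotaDl big_map.
by rewrite /index_iota subn0.
Qed.

(** A crown word with an odd number of variables differs from a product of
    blocks only by the initial power of its first variable and the final power
    of its last one; at both ends the value 1 makes the difference vanish. *)
Lemma eval_crown_arc (S : Type) (one : S) (mul : Monoid.law one)
    (a b : nat -> S) (x : nat -> nat) i h :
    a (outer i) = one -> a (outer (i + h)) = one ->
    (forall t, b (x t.*2.+1) = a (outer (i + t))) ->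
    (forall t, b (x t.*2.+2) = a (inner (i + t))) ->
  word_eval mul b (crown x h.*2.+1 p q) = word_eval mul a (crown_arc i h).
Proof.
move=> a_i a_ih b_o b_e; rewrite /crown /= odd_double /=.
rewrite !word_eval_cat !word_eval_nseq (b_o 0) addn0 a_i b_o a_ih !spow1n.
rewrite Monoid.mul1m Monoid.mulm1 uphalf_double eval_crown_arcE.
rewrite (big_morph (word_eval mul b) (@word_eval_cat _ _ mul _ b)
  (big_nil _ _ _ _)).
rewrite big_add1; apply: eq_bigr => k _.
by rewrite !word_eval_cat !word_eval_nseq !doubleS /= b_o b_e -doubleS b_o
  addnS.
Qed.

End CyclicWord.

(** * Independence of the starting block *)

Section Gluing.

Variables (S : eqType) (one : S) (mul : Monoid.law one).
Variables p q m : nat.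
Hypothesis crowns_commute : forall m n, 0 < m -> 0 < n ->
  satisfies mul (crown xvar n p q ++ crown yvar m p q)
                (crown yvar m p q ++ crown xvar n p q).
Variables alpha beta : nat.
Hypothesis alpha_gt0 : 0 < alpha.
Hypothesis alpha_le : alpha <= 2 * p + 2 * q.
Hypothesis mul_A : satisfies_A mul alpha beta.

Lemma crown_arcs_commute (a : nat -> S) i h k l :
    a (outer m i) = one -> a (outer m (i + h)) = one ->
    a (outer m k) = one -> a (outer m (k + l)) = one ->
  word_eval mul a (crown_arc p q m i h ++ crown_arc p q m k l) =
  word_eval mul a (crown_arc p q m k l ++ crown_arc p q m i h).
Proof.
move=> a_i a_ih a_k a_kl.
(* [c j] assigns to the variables 1, 2, 3, ... of a crown word the values of
   outer j, inner j, outer (j + 1), and so on. *)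
pose c j z := if z is t.+1 then
  if odd t then a (inner m (j + t./2)) else a (outer m (j + t./2)) else one.
pose b z := if odd z then c k z./2 else c i z./2.
have := @crowns_commute l.*2.+1 h.*2.+1 isT isT b.
rewrite !word_eval_cat !(@eval_crown_arc p q m _ _ _ a b xvar i h).
- rewrite !(@eval_crown_arc p q m _ _ _ a b yvar k l) // => t;
  rewrite /b /yvar /= odd_double /= ?uphalf_double ?doubleK /= ?odd_double /=;
  by rewrite ?uphalf_double ?doubleK.
- by [].
- by [].
- by move=> t; rewrite /b /xvar odd_double doubleK /= odd_double /= doubleK.
by move=> t; rewrite /b /xvar odd_double doubleK /= odd_double /= uphalf_double.
Qed.

Lemma eval_cyclic_word_rotate (a : nat -> S) i k : i < m -> k < m ->
    a (outer m i) = one -> a (outer m k) = one ->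
  word_eval mul a (cyclic_word p q m i) =
  word_eval mul a (cyclic_word p q m k).
Proof.
wlog le_ik : i k / i <= k => [wl lt_i lt_k a_i a_k|lt_i lt_k a_i a_k].
  by case: (leqP i k) => [|/ltnW] le_ik; last symmetry; apply: wl.
rewrite (@cyclic_word_split _ _ _ i k) ?(@cyclic_word_rotate _ _ _ i k) //;
  try lia.
apply: crown_arcs_commute => //; first by rewrite subnKC.
by rewrite subnKC; [rewrite /outer modnDr | lia].
Qed.

(** The words starting at [i] and at [k] are permutations of each other, so
    extracting all outer letters with the value of [outer i], and then those
    with the value of [outer k], produces the same powers in both words.  The
    remaining evaluations have the value 1 at both cuts. *)
Lemma eval_cyclic_word_repeat (a : nat -> S) i j k l :
    i < m -> j < m -> k < m -> l < m -> i != j -> k != l ->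
    a (outer m i) = a (outer m j) -> a (outer m k) = a (outer m l) ->
  word_eval mul a (cyclic_word p q m i) =
  word_eval mul a (cyclic_word p q m k).
Proof.
move=> lt_i lt_j lt_k lt_l neq_ij neq_kl eq_ij eq_kl.
pose P s z := ~~ odd z && (a z == s).
have P_even s z : P s z -> ~~ odd z by case/andP.
have outer_even n : ~~ odd (outer m n) by rewrite /outer odd_double.
have aP s z : P s z -> a z = s by case/andP => _ /eqP.
have countP s n : n < m -> s \in [:: a (outer m i); a (outer m k)] ->
    2 * p + 2 * q <= count (P s) (cyclic_word p q m n).
  move=> lt_n; rewrite !inE => /orP[]/eqP->.
    apply: (@count_cyclic_word _ _ _ _ i j) => //; first exact: P_even.
      by rewrite /P outer_even eqxx.
    by rewrite /P outer_even -eq_ij eqxx.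
  apply: (@count_cyclic_word _ _ _ _ k l) => //; first exact: P_even.
    by rewrite /P outer_even eqxx.
  by rewrite /P outer_even -eq_kl eqxx.
have perm_ik := @perm_cyclic_word p q m i k lt_i lt_k.
set s := a (outer m i) in countP *; set t := a (outer m k) in countP *.
pose a1 z := if P s z then one else a z.
have pull1 n : n < m -> word_eval mul a (cyclic_word p q m n) =
    mul (spow mul s (count (P s) (cyclic_word p q m n)))
        (word_eval mul a1 (cyclic_word p q m n)).
  move=> lt_n; apply: (extract_letter alpha_gt0 mul_A); first exact: aP.
  by apply: leq_trans alpha_le _; apply: countP; rewrite ?inE ?eqxx.
have a1_i : a1 (outer m i) = one by rewrite /a1 /P outer_even eqxx.
rewrite !pull1 // (permP perm_ik); congr (mul _ _).
have [eq_st|neq_st] := eqVneq s t.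
  apply: eval_cyclic_word_rotate => //.
  by rewrite /a1 /P outer_even -/t -eq_st eqxx.
pose a2 z := if P t z then one else a1 z.
have a1P z : P t z -> a1 z = t.
  move=> Ptz; rewrite /a1 /P; case/andP: (Ptz) => -> /eqP->.
  by rewrite eq_sym (negbTE neq_st).
have pull2 n : n < m -> word_eval mul a1 (cyclic_word p q m n) =
    mul (spow mul t (count (P t) (cyclic_word p q m n)))
        (word_eval mul a2 (cyclic_word p q m n)).
  move=> lt_n; apply: (extract_letter alpha_gt0 mul_A); first exact: a1P.
  by apply: leq_trans alpha_le _; apply: countP; rewrite ?inE ?eqxx ?orbT.
rewrite !pull2 // (permP perm_ik); congr (mul _ _).
apply: eval_cyclic_word_rotate => //; first by rewrite /a2 a1_i if_same.
by rewrite /a2 /P outer_even eqxx.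
Qed.

End Gluing.

(** * Projecting a word to a few letters *)

Definition before (L : eqType) (x y : L) (w : seq L) :=
  exists w1 w2, [/\ w = w1 ++ w2, x \in w1 & y \notin w1].

Section Projection.

Variable L : eqType.
Implicit Types (ls w : seq L) (z : L).

(** The letters of [ls] are renamed 0, 1, 2, ... in the order of [ls], so that
    projections can be compared with words over the alphabet of identities. *)
Definition proj ls w := [seq index z ls | z <- w & z \in ls].

Lemma proj_cat ls w1 w2 : proj ls (w1 ++ w2) = proj ls w1 ++ proj ls w2.
Proof. by rewrite /proj filter_cat map_cat. Qed.

Lemma proj_nseq ls n z :
  proj ls (nseq n z) = if z \in ls then nseq n (index z ls) else [::].
Proof.
rewrite /proj; elim: n => [|n /= IHn]; first by case: ifP.
by case: ifP IHn => //= _ ->.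
Qed.

Lemma proj_nil ls w : {in w, forall z, z \notin ls} -> proj ls w = [::].
Proof.
move=> notin; rewrite /proj (eq_in_filter (a2 := pred0)) ?filter_pred0 //.
by move=> z /notin/negbTE.
Qed.

Lemma count_proj ls w z :
  z \in ls -> count_mem (index z ls) (proj ls w) = count_mem z w.
Proof.
move=> ls_z; rewrite count_map count_filter; apply: eq_count => y /=.
have [->|neq_yz] := eqVneq y z; first by rewrite eqxx ls_z.
case: (boolP (y \in ls)) => ls_y; rewrite ?andbF // andbT.
apply/negbTE/negP => /eqP eq_index; case/eqP: neq_yz.
by rewrite -(nth_index z ls_y) eq_index nth_index.
Qed.

Lemma mem_proj ls w z : z \in ls -> (index z ls \in proj ls w) = (z \in w).
Proof. by move=> ls_z; rewrite -!has_pred1 !has_count count_proj. Qed.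

Lemma proj_take ls w j : exists k, proj ls (take j w) = take k (proj ls w).
Proof.
exists (size (proj ls (take j w))).
by rewrite -{3}(cat_take_drop j w) proj_cat take_size_cat.
Qed.

Lemma take_proj ls w k : exists j, proj ls (take j w) = take k (proj ls w).
Proof.
elim: w k => [|z w IHw] k; first by exists 0.
rewrite /proj /=; case: ifP => ls_z.
  case: k => [|k]; first by exists 0.
  by have [j Ej] := IHw k; exists j.+1; rewrite /= ls_z /= -Ej.
by have [j Ej] := IHw k; exists j.+1; rewrite /= ls_z -Ej.
Qed.

Lemma index_before x y w :
  x != y -> x \in w -> index x w <= index y w -> before x y w.
Proof.
move=> neq_xy w_x le_xy; exists (take (index y w) w), (drop (index y w) w).
rewrite cat_take_drop; split=> //.
  rewrite in_take // ltn_neqAle le_xy andbT; apply: contraNneq neq_xy => eq_xy.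
  have w_y : y \in w by rewrite -index_mem -eq_xy index_mem.
  by rewrite -(nth_index x w_x) eq_xy nth_index.
apply/negP => y_take; have y_w := mem_take y_take.
by rewrite in_take // ltnn in y_take.
Qed.

Lemma before_proj ls x y w : x \in ls -> y \in ls ->
  before x y w -> before (index x ls) (index y ls) (proj ls w).
Proof.
move=> ls_x ls_y [w1 [w2 [-> w1_x w1_y]]]; exists (proj ls w1), (proj ls w2).
by rewrite proj_cat !mem_proj.
Qed.

End Projection.

Lemma count_take_nseq (T : eqType) (P : pred T) k n z t :
  count P (take k (nseq n z ++ t)) = P z * minn k n + count P (take (k - n) t).
Proof.
rewrite take_cat size_nseq; case: ltnP => [lt_kn|le_nk].
  rewrite take_nseq ?count_nseq; last exact: ltnW.
  have -> : k - n = 0 by lia.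
  by rewrite take0 addn0; congr (_ * _); lia.
by rewrite count_cat count_nseq; congr (_ * _ + _); lia.
Qed.

Lemma count_take_nseq1 (T : eqType) (P : pred T) k n z :
  count P (take k (nseq n z)) = P z * minn k n.
Proof. by rewrite -[nseq n z]cats0 count_take_nseq /= addn0. Qed.

(** * Nested and unnested pairs of letters *)

Section Pairs.

Variables p q : nat.
Hypotheses (p_gt0 : 0 < p) (q_gt0 : 0 < q).

Definition nested_word := nseq p 0 ++ nseq (p + q) 1 ++ nseq q 0.

Definition unnested_words :=
  [:: nseq p 0 ++ nseq p 1 ++ nseq q 0 ++ nseq q 1;
      nseq p 1 ++ nseq p 0 ++ nseq q 1 ++ nseq q 0;
      nseq (p + q) 0 ++ nseq (p + q) 1;
      nseq (p + q) 1 ++ nseq (p + q) 0].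

Variable L : eqType.
Implicit Types (x y : L) (w : seq L).

(** Prefixes of [w] and prefixes of its projection correspond to each other.
    The letter counts of prefixes thus turn the shape of a projection into
    linear inequalities, which this lemma and the next one transport. *)
Lemma count_prefix_proj x y w j : x != y -> exists k,
  count_mem x (take j w) = count_mem 0 (take k (proj [:: x; y] w)) /\
  count_mem y (take j w) = count_mem 1 (take k (proj [:: x; y] w)).
Proof.
move=> neq_xy; have [k Ek] := proj_take [:: x; y] w j; exists k; rewrite -Ek.
have := @count_proj _ [:: x; y] (take j w) x; rewrite inE /= eqxx => -> //.
have := @count_proj _ [:: x; y] (take j w) y.
by rewrite !inE /= (negbTE neq_xy) eqxx orbT => ->.
Qed.

Lemma prefix_count_proj x y w k : x != y -> exists j,
  count_mem x (take j w) = count_mem 0 (take k (proj [:: x; y] w)) /\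
  count_mem y (take j w) = count_mem 1 (take k (proj [:: x; y] w)).
Proof.
move=> neq_xy; have [j Ek] := take_proj [:: x; y] w k; exists j; rewrite -Ek.
have := @count_proj _ [:: x; y] (take j w) x; rewrite inE /= eqxx => -> //.
have := @count_proj _ [:: x; y] (take j w) y.
by rewrite !inE /= (negbTE neq_xy) eqxx orbT => ->.
Qed.

Lemma nested_gap x y w : x != y -> proj [:: x; y] w = nested_word ->
  (exists j, count_mem x (take j w) = p /\ count_mem y (take j w) = 0) /\
  (exists j, count_mem x (take j w) = p /\ count_mem y (take j w) = p + q).
Proof.
move=> neq_xy E; split.
  have [j] := prefix_count_proj w p neq_xy.
  rewrite E !count_take_nseq !count_take_nseq1 /= => -[Ex Ey].
  by exists j; lia.
have [j] := prefix_count_proj w (p + (p + q)) neq_xy.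
rewrite E !count_take_nseq !count_take_nseq1 /= => -[Ex Ey].
by exists j; lia.
Qed.

(** If [x] comes first, the only possible projections are x^p y^p x^q y^q and
    x^(p+q) y^(p+q). *)
Lemma unnested_before x y w j : x != y ->
    proj [:: x; y] w \in unnested_words -> before x y w ->
  (0 < count_mem y (take j w) -> p <= count_mem x (take j w)) /\
  (count_mem x (take j w) <= p -> count_mem y (take j w) <= p).
Proof.
move=> neq_xy E [w1 [w2 [w_eq w1_x w1_y]]].
have [i] := @count_prefix_proj x y w (size w1) neq_xy.
rewrite {1 3}w_eq take_size_cat // (count_memPn w1_y).
have : 0 < count_mem x w1 by rewrite -has_count has_pred1.
have [k] := count_prefix_proj w j neq_xy.
by move: E; rewrite !inE => /or4P[] /eqP ->;
  rewrite !count_take_nseq !count_take_nseq1 /=; lia.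
Qed.

(** The two prefixes would witness that all of the [y] stand between the first
    [p] and the last [q] occurrences of [x]. *)
Lemma unnested_no_gap x y w j j' : x != y ->
    proj [:: x; y] w \in unnested_words ->
    p <= count_mem x (take j w) -> count_mem y (take j w) = 0 ->
    count_mem x (take j' w) <= p -> count_mem y (take j' w) = p + q -> False.
Proof.
move=> neq_xy E.
have [k] := count_prefix_proj w j neq_xy.
have [k'] := count_prefix_proj w j' neq_xy.
by move: E; rewrite !inE => /or4P[] /eqP ->;
  rewrite !count_take_nseq !count_take_nseq1 /=; lia.
Qed.

(** Just before the first [t], the [p]-th occurrence of [z] has passed, hence
    also that of [y], which started earlier; just after the last [t], the last
    [q] occurrences of [x] are still to come, hence also those of [y].  So [t]
    would be nested in [y]. *)
Lemma no_straddling_letter x y z t w :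
    uniq [:: x; y; z; t] -> before x y w -> before y z w ->
    proj [:: x; t] w = nested_word -> proj [:: z; t] w = nested_word ->
    proj [:: x; y] w \in unnested_words ->
    proj [:: y; z] w \in unnested_words ->
    proj [:: y; t] w \in unnested_words -> False.
Proof.
move=> distinct lt_xy lt_yz Ext Ezt Exy Eyz Eyt.
move: distinct; rewrite /= !inE !negb_or.
case/and4P=> [/and3P[xy _ xt] /andP[yz yt] zt _].
have [_ [j' [xj' tj']]] := nested_gap xt Ext.
have [[j [zj tj]] _] := nested_gap zt Ezt.
apply: (@unnested_no_gap y t w j j') => //.
  by have [+ _] := unnested_before j yz Eyz lt_yz; rewrite zj; exact.
by have [_] := unnested_before j' xy Exy lt_xy; rewrite xj'; exact.
Qed.

End Pairs.

(** * Identities, isoterms and islands under projection *)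

Section Satisfaction.

Variables (S : Type) (one : S) (mul : Monoid.law one).

Lemma word_eval_proj (L : eqType) (ls : seq L) (b : nat -> S) w :
  word_eval mul b (proj ls w) =
  word_eval mul (fun z => if z \in ls then b (index z ls) else one) w.
Proof. by rewrite /word_eval big_map big_filter big_mkcond. Qed.

Lemma satisfies_proj ls u v :
  satisfies mul u v -> satisfies mul (proj ls u) (proj ls v).
Proof. by move=> uv a; rewrite !word_eval_proj uv. Qed.

Lemma satisfies_sym u v : satisfies mul u v -> satisfies mul v u.
Proof. by move=> uv a. Qed.

(** Isoterms and islands are tested on nonempty words only.  The empty word is
    excluded because a word equivalent to it is equivalent to its own square,
    which has the wrong length. *)
Lemma satisfies_nil_square v : satisfies mul [::] v -> satisfies mul (v ++ v) v.
Proof.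
move=> v1 a; rewrite word_eval_cat -v1 /word_eval big_nil.
exact: Monoid.mul1m.
Qed.

Lemma isoterm_eq v : v != [::] -> isoterm mul v ->
  forall u, satisfies mul u v -> u = v.
Proof.
move=> v_neq0 iso_v [|x u] uv; last exact: iso_v.
have vv_neq0 : v ++ v != [::] by case: (v) v_neq0.
have /(congr1 size) := iso_v _ vv_neq0 (satisfies_nil_square uv).
by case: (v) v_neq0 => //= x v' _; rewrite size_cat /=; lia.
Qed.

Lemma island_mem us n :
  0 < n -> {in us, forall v, size v = n} -> island mul us ->
  forall u v, v \in us -> satisfies mul u v -> u \in us.
Proof.
move=> n_gt0 us_n [_ isl] u v us_v uv.
case: u uv => [|x u] uv; last by apply/(isl v) => //; exact: satisfies_sym.
have vv_neq0 : v ++ v != [::] by rewrite -size_eq0 size_cat us_n; lia.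
have vvv := satisfies_sym (satisfies_nil_square uv).
have /us_n := iffLR (isl _ _ us_v vv_neq0) vvv.
by rewrite size_cat us_n; lia.
Qed.

End Satisfaction.

(** * Three consecutive outer letters of the cycle *)

Section Window.

Variables (p q m s : nat).
Hypothesis m_ge5 : 5 <= m.

(** The three outer letters are far enough from the cut at [outer s] for their
    neighbourhood to look as in the uncut cycle.  Five outer letters are needed:
    besides these three, two more that may be identified with each other. *)
Definition window := [:: outer m (s + 1); outer m (s + 2); inner m (s + 1);
  outer m (s + 3); inner m (s + 2)].

Definition window_word :=
  nseq p 0 ++ nseq p 1 ++ nseq (p + q) 2 ++ nseq q 0 ++
  nseq p 3 ++ nseq (p + q) 4 ++ nseq q 1 ++ nseq q 3.

Lemma outer_eq a b :
  a < m -> b < m -> (outer m (s + a) == outer m (s + b)) = (a == b).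
Proof.
move=> lt_a lt_b; rewrite /outer -!muln2 eqn_pmul2r // eqn_modDl.
by rewrite !modn_small.
Qed.

Lemma inner_eq a b :
  a < m -> b < m -> (inner m (s + a) == inner m (s + b)) = (a == b).
Proof. by move=> lt_a lt_b; rewrite /inner eqSS outer_eq. Qed.

Lemma outer_inner a b : (outer m a == inner m b) = false.
Proof. by apply/eqP => /(congr1 odd); rewrite /= !odd_double. Qed.

Lemma inner_outer a b : (inner m a == outer m b) = false.
Proof. by rewrite eq_sym outer_inner. Qed.

Lemma outerD_modulus : outer m (s + m) = outer m (s + 0).
Proof. by rewrite /outer modnDr addn0. Qed.

Lemma window_uniq : uniq window.
Proof.
by rewrite /= !inE !outer_eq ?inner_eq ?outer_inner ?inner_outer //; lia.
Qed.

Lemma proj_window : proj window (cyclic_word p q m s) = window_word.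
Proof.
have lt4 : 4 < m by [].
have lt3 : 3 < m by lia.
have lt2 : 2 < m by lia.
have lt1 : 1 < m by lia.
have lt0 : 0 < m by lia.
have m4 : m = 4 + (m - 4) by lia.
(* All occurrences of the five letters are in the first four blocks. *)
rewrite /cyclic_word {2}m4 crown_arcD proj_cat [X in _ ++ X]proj_nil ?cats0.
  have blockE a : block p q m (s + a) = nseq p (outer m (s + a.+1)) ++
      nseq (p + q) (inner m (s + a)) ++ nseq q (outer m (s + a)).
    by rewrite /block addnS.
  have -> : crown_arc p q m s 4 = block p q m (s + 0) ++ block p q m (s + 1) ++
      block p q m (s + 2) ++ block p q m (s + 3).
    by rewrite /crown_arc /= cats0 addn0 addn1 addn2 addn3.
  rewrite !blockE !proj_cat !proj_nseq !inE /=.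
  rewrite !(outer_eq, inner_eq, outer_inner, inner_outer) //=.
  by rewrite !cats0 -!catA.
move=> z /flattenP[v /mapP[k]]; rewrite mem_iota => /andP[le_k lt_k] ->.
have [a [le4a lt_am ->]] : exists a, [/\ 4 <= a, a < m & k = s + a].
  by exists (k - s); split; lia.
rewrite /block !mem_cat !mem_nseq => /or3P[] /andP[_ /eqP->].
- rewrite -addnS.
  case: (ltnP a.+1 m) => [lt_aS|ge_aS].
    by rewrite !inE !(outer_eq, outer_inner) //; lia.
  have -> : a.+1 = m by lia.
  by rewrite outerD_modulus !inE !(outer_eq, outer_inner).
- by rewrite !inE !(inner_eq, inner_outer) //; lia.
by rewrite !inE !(outer_eq, outer_inner) //; lia.
Qed.

End Window.

(** * The function of the cyclic crown *)

Section GluedFunction.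

Variables (S : finType) (one : S) (mul : Monoid.law one) (p q m : nat).

Definition repeats (a : nat -> S) (i : 'I_m) :=
  [exists j : 'I_m, (j != i) && (a (outer m i) == a (outer m j))].

(** By [glued_eq] below, the value does not depend on the index that is picked;
    the default branch is only reached when [m <= #|S|]. *)
Definition glued (a : m.*2.-tuple S) : S :=
  if [pick i | repeats (nth one a) i] is Some i
  then word_eval mul (nth one a) (cyclic_word p q m i) else one.

Lemma cyclic_word_bound i :
  0 < m -> {in cyclic_word p q m i, forall z, z < m.*2}.
Proof.
move=> m_gt0 z /flattenP[v /mapP[k _ ->]].
rewrite /block !mem_cat !mem_nseq => /or3P[] /andP[_ /eqP->];
  by rewrite /outer /inner ?ltn_double ?ltn_Sdouble ltn_mod.
Qed.

Hypothesis m_ge5 : 5 <= m.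

Section Agreement.

Hypothesis crowns_commute : forall m n, 0 < m -> 0 < n ->
  satisfies mul (crown xvar n p q ++ crown yvar m p q)
                (crown yvar m p q ++ crown xvar n p q).
Variables alpha beta : nat.
Hypothesis alpha_gt0 : 0 < alpha.
Hypothesis alpha_le : alpha <= 2 * p + 2 * q.
Hypothesis mul_A : satisfies_A mul alpha beta.

Lemma glued_eq (a : m.*2.-tuple S) (i j : 'I_m) : i != j ->
    nth one a (outer m i) = nth one a (outer m j) ->
  glued a = word_eval mul (nth one a) (cyclic_word p q m i).
Proof.
move=> neq_ij eq_ij; rewrite /glued.
case: pickP => [k rep_k|/(_ i) no_rep]; last first.
  case/negP: (negbT no_rep); apply/existsP; exists j.
  by rewrite eq_sym neq_ij eq_ij /=.
have /existsP[l /andP[neq_lk /eqP eq_kl]] := rep_k.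
apply: (eval_cyclic_word_repeat crowns_commute alpha_gt0 alpha_le mul_A
  (j := l) (l := j)) => //.
by rewrite eq_sym.
Qed.

(** Two of the rows at outer positions coincide by the pigeonhole principle.
    One word then computes the function in all coordinates. *)
Lemma glued_preserves (k : nat) (R : k.-tuple S -> Prop) :
    #|S| ^ k < m ->
    (forall f, term_function mul f -> @preserves S m.*2 k f R) ->
  preserves glued R.
Proof.
move=> lt_m R_inv r Rr.
pose row (i : nat) := nth (nseq_tuple k one) r (outer m i).
have [i [j [neq_ij eq_ij]]] : exists i j : 'I_m, i != j /\ row i = row j.
  have /injectivePn[i [j neq_ij eq_ij]] : ~~ injectiveb (fun i : 'I_m => row i).
    apply/negP => /injectiveP /leq_card; rewrite card_ord card_tuple; lia.
  by exists i, j.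
have m2_gt0 : 0 < m.*2 by lia.
pose u := map (insubd (Ordinal m2_gt0)) (cyclic_word p q m i).
have u_term : term_function mul
    (fun a : m.*2.-tuple S => word_eval mul (tnth a) u).
  exists u => //; rewrite -size_eq0 size_map -lt0n.
  apply: leq_trans (count_size (fun z => ~~ odd z) _).
  apply: leq_trans (@count_cyclic_word p q m _ i j i _ _ _ neq_ij _ _ _) => //.
  - by lia.
  - by rewrite /outer odd_double.
  by rewrite /outer odd_double.
have := R_inv _ u_term r Rr.
suff -> : [tuple word_eval mul (tnth [tuple tnth (tnth r i) j | i < m.*2]) u
      | j < k] =
    [tuple glued [tuple tnth (tnth r i) j | i < m.*2] | j < k] by [].
apply: eq_from_tnth => c; rewrite !tnth_mktuple.
set a := [tuple _ | _ < _].
have aE z (lt_z : z < m.*2) :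
    nth one a z = tnth (nth (nseq_tuple k one) r z) c.
  rewrite -(tnth_nth one a (Ordinal lt_z)) tnth_mktuple.
  by rewrite (tnth_nth (nseq_tuple k one)).
have lt_outer t : outer m t < m.*2 by rewrite /outer ltn_double ltn_mod; lia.
rewrite (@glued_eq a i j) //; last by rewrite !aE // -/(row i) eq_ij.
rewrite word_eval_map; apply: eq_word_eval_in => z /cyclic_word_bound lt_z /=.
rewrite (tnth_nth one) val_insubd lt_z //; lia.
Qed.

(** Evaluate at tuples that are 1 outside [ls]: there [outer i] and [outer j]
    have the same value, and the word starting at [i] gives the function. *)
Lemma glued_proj (w : seq 'I_m.*2) (ls : seq nat) (i j : 'I_m) :
    (forall a, glued a = word_eval mul (tnth a) w) ->
    i != j -> outer m i \notin ls -> outer m j \notin ls ->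
  satisfies mul (proj ls (map val w)) (proj ls (cyclic_word p q m i)).
Proof.
move=> wE neq_ij ls_i ls_j b; rewrite !word_eval_proj.
set g := fun z => _.
pose a := [tuple g z | z < m.*2].
have aE z : z < m.*2 -> nth one a z = g z.
  by move=> lt_z; rewrite -(tnth_nth one a (Ordinal lt_z)) tnth_mktuple.
have lt_outer t : outer m t < m.*2 by rewrite /outer ltn_double ltn_mod; lia.
transitivity (glued a).
  rewrite wE word_eval_map; apply: eq_word_eval_in => z _ /=.
  by rewrite tnth_mktuple.
rewrite (@glued_eq a i j) //; last first.
  by rewrite !aE // /g (negbTE ls_i) (negbTE ls_j).
apply: eq_word_eval_in => z /cyclic_word_bound lt_z; apply: aE.
by apply: lt_z; lia.
Qed.

Lemma glued_window (w : seq 'I_m.*2) (s : 'I_m) :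
    (forall a, glued a = word_eval mul (tnth a) w) ->
  satisfies mul (proj (window m s) (map val w)) (window_word p q).
Proof.
move=> wE; rewrite -(@proj_window p q m s m_ge5).
have m_gt0 : 0 < m by lia.
have outer4 : outer m ((s + 4) %% m) = outer m (s + 4).
  by rewrite /outer modn_mod.
have neq4 : outer m (s + 0) != outer m (s + 4) by rewrite outer_eq.
apply: (@glued_proj w _ s (Ordinal (ltn_pmod (s + 4) m_gt0)) wE).
- apply: contraNneq neq4 => /(congr1 (fun t : 'I_m => outer m t)) /= eq_s.
  by rewrite addn0 eq_s outer4.
- have -> : outer m s = outer m (s + 0) by rewrite addn0.
  by rewrite !inE !outer_eq ?outer_inner //; lia.
by rewrite /= outer4 !inE !outer_eq ?outer_inner //; lia.
Qed.

Hypotheses (p_gt0 : 0 < p) (q_gt0 : 0 < q).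
Hypothesis nested_isoterm : isoterm mul (nested_word p q).
Hypothesis unnested_island : island mul (unnested_words p q).

Lemma unnested_mem u v :
  v \in unnested_words p q -> satisfies mul u v -> u \in unnested_words p q.
Proof.
apply: (island_mem (n := 2 * (p + q))) => //; first by lia.
by move=> w; rewrite !inE => /or4P[] /eqP->; rewrite !size_cat !size_nseq; lia.
Qed.

Lemma glued_not_term : ~ term_function mul glued.
Proof.
case=> w _ wE; pose v := map val w.
have m_gt0 : 0 < m by lia.
(* The window is placed so that its middle outer letter is the one that starts
   first in [w]. *)
have [s s_min] : exists s : 'I_m, forall t,
    index (outer m (s + 2)) v <= index (outer m t) v.
  pose start (k : 'I_m) := index (outer m k) v.
  case: (@arg_minnP _ (Ordinal m_gt0) xpredT start isT) => k _ k_min.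
  exists (Ordinal (ltn_pmod (k + m - 2) m_gt0)) => t.
  have -> : outer m ((k + m - 2) %% m + 2) = outer m k.
    by rewrite /outer modnDml (_ : k + m - 2 + 2 = k + m) ?modnDr //; lia.
  have := k_min (Ordinal (ltn_pmod t m_gt0)) isT.
  by rewrite /start /outer /= modn_mod.
have uniq_ls := window_uniq s m_ge5.
set ls := window m s in uniq_ls; pose u := proj ls v.
have uE : satisfies mul u (window_word p q) by exact: glued_window.
have nestedE x y : proj [:: x; y] (window_word p q) = nested_word p q ->
    proj [:: x; y] u = nested_word p q.
  move=> E; apply: (isoterm_eq _ nested_isoterm); last first.
    by rewrite -E; exact: satisfies_proj.
  by rewrite -size_eq0 !size_cat !size_nseq; lia.
have unnestedE x y : proj [:: x; y] (window_word p q) \in unnested_words p q ->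
    proj [:: x; y] u \in unnested_words p q.
  by move=> /unnested_mem; apply; exact: satisfies_proj.
(* In the window word the outer letters are 0, 1, 3 in cyclic order; the inner
   letter 2 lies between 0 and 1, the inner letter 4 between 1 and 3. *)
have E12 : proj [:: 1; 2] u = nested_word p q.
  by apply: nestedE; rewrite /window_word !proj_cat !proj_nseq /= ?cats0.
have E02 : proj [:: 0; 2] u = nested_word p q.
  by apply: nestedE; rewrite /window_word !proj_cat !proj_nseq /= ?cats0.
have E14 : proj [:: 1; 4] u = nested_word p q.
  by apply: nestedE; rewrite /window_word !proj_cat !proj_nseq /= ?cats0.
have E34 : proj [:: 3; 4] u = nested_word p q.
  by apply: nestedE; rewrite /window_word !proj_cat !proj_nseq /= ?cats0.
have Eun x y :
    (x, y) \in [:: (1, 3); (1, 0); (3, 0); (0, 3); (3, 2); (0, 4)] ->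
    proj [:: x; y] u \in unnested_words p q.
  move=> xy; apply: unnestedE; move: xy; rewrite !inE.
  by move=> /or4P[||| /or3P[]] /eqP[-> ->];
    rewrite /window_word !proj_cat !proj_nseq /= ?cats0 ?catA -?nseqD;
    rewrite -?catA -?nseqD eqxx ?orbT.
have memE i : i < 5 -> (i \in u) = (nth 0 ls i \in v).
  by move=> lt_i; rewrite -(@mem_proj _ ls v) ?mem_nth // index_uniq.
have mem_u i j : proj [:: i; j] u = nested_word p q -> i \in u.
  move=> E; rewrite -(@mem_proj _ [:: i; j]) ?inE ?eqxx // E /= eqxx.
  by rewrite mem_cat mem_nseq p_gt0.
have u0 := mem_u _ _ E02; have u1 := mem_u _ _ E12; have u3 := mem_u _ _ E34.
have beforeE i j : i < 5 -> j < 5 -> i != j -> i \in u ->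
    index (nth 0 ls i) v <= index (nth 0 ls j) v -> before i j u.
  move=> lt_i lt_j neq_ij u_i le_ij.
  have := @before_proj _ ls (nth 0 ls i) (nth 0 ls j) v.
  rewrite !index_uniq //; apply; rewrite ?mem_nth //.
  by apply: index_before; rewrite ?nth_uniq -?memE.
have b13 : before 1 3 u by apply: beforeE => //; exact: s_min.
have b10 : before 1 0 u by apply: beforeE => //; exact: s_min.
case: (leqP (index (nth 0 ls 3) v) (index (nth 0 ls 0) v)).
  move=> le30; have b30 : before 3 0 u by exact: beforeE.
  by apply: (no_straddling_letter p_gt0 q_gt0 _ b13 b30 E12 E02); rewrite ?Eun.
move=> /ltnW le03; have b03 : before 0 3 u by exact: beforeE.
by apply: (no_straddling_letter p_gt0 q_gt0 _ b10 b03 E14 E34); rewrite ?Eun.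
Qed.

End Agreement.
End GluedFunction.

Theorem theorem4p18 (S : finType) (one : S) (mul : Monoid.law one) :
  (exists p q : nat,
    [/\ 0 < p, 0 < q &
     [/\ forall m n : nat, 0 < m -> 0 < n ->
          satisfies mul (crown xvar n p q ++ crown yvar m p q)
                        (crown yvar m p q ++ crown xvar n p q),
        exists alpha beta : nat,
          [/\ 0 < alpha, 0 < beta, alpha <= 2 * p + 2 * q
            & satisfies_A mul alpha beta],
        isoterm mul (nseq p 0 ++ nseq (p + q) 1 ++ nseq q 0)
      & island mul
          [:: nseq p 0 ++ nseq p 1 ++ nseq q 0 ++ nseq q 1;
              nseq p 1 ++ nseq p 0 ++ nseq q 1 ++ nseq q 0;
              nseq (p + q) 0 ++ nseq (p + q) 1;
              nseq (p + q) 1 ++ nseq (p + q) 0]]]) ->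
  ~ finitely_related (@term_function S one mul).
Proof.
case=> p [q [p_gt0 q_gt0 [comm [alpha [beta [a_gt0 _ a_le mul_A]]] iso isl]]].
case=> r [k [R related]].
(* A relation of arity k has at most |S|^k elements. *)
pose m := (\max_(i < r) #|S| ^ k i) + 5.
have m_ge5 : 5 <= m by rewrite leq_addl.
have m2_gt0 : 0 < m.*2 by rewrite double_gt0 (leq_trans _ m_ge5).
apply: (glued_not_term m_ge5 comm a_gt0 a_le mul_A p_gt0 q_gt0 iso isl).
apply/(related _ _ m2_gt0) => i.
apply: (glued_preserves m_ge5 comm a_gt0 a_le mul_A).
  have := @leq_bigmax_cond _ xpredT (fun i : 'I_r => #|S| ^ k i) i isT.
  by move/leq_ltn_trans; apply; rewrite -[X in X < _]addn0 ltn_add2l.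
by move=> f /(related _ _ m2_gt0).
Qed.
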